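(* Let $U$ be a convex subset of the plane, let $D\subset U$ be an annulus with center $O$ and radii $0<r<R$, and let $f\colon U\to\mathbb{R}$ be convex. For $s>0$ let $C(s)$ be the circle with center $O$ and radius $s$. Then $$\operatorname{Avg}(f,D)\le\frac13\left[\frac{R}{r+R}\operatorname{Avg}\left(f,C\left(\frac{r+2R}{3}\right)\right)+\frac{r}{r+R}\operatorname{Avg}\left(f,C\left(\frac{2r+R}{3}\right)\right)\right]$$ $$\qquad+\frac23\left[\frac{r+2R}{3(r+R)}\operatorname{Avg}(f,C(R))+\frac{2r+R}{3(r+R)}\operatorname{Avg}(f,C(r))\right].$$
   Context: $\operatorname{Avg}(f,D)=\frac{1}{\operatorname{Area}(D)}\iint_D f$ is the average over the annulus with respect to area, and $\operatorname{Avg}(f,C(s))=\frac{1}{2\pi s}\int_{C(s)}f\,ds$ is the average over the circle with respect to arc length. *)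

(* Defs.v *)
From HB Require Import structures.
From mathcomp Require Import all_boot all_order all_algebra.
From mathcomp Require Import all_classical all_reals all_analysis.
Set Implicit Arguments. Unset Strict Implicit. Unset Printing Implicit Defensive.
Import Order.TTheory GRing.Theory Num.Theory.
Import numFieldNormedType.Exports.
Local Open Scope classical_set_scope.
Local Open Scope ring_scope.

Section Defs.
Variable R : realType.

(* Points of the plane are pairs (x, y) : R * R (an lmodType over R, so the
   library's convex_set / convex_function from convex.v apply). *)

Definition edist (p q : R * R) : R :=
  Num.sqrt ((p.1 - q.1) ^+ 2 + (p.2 - q.2) ^+ 2).

Definition annulus (O : R * R) (r R' : R) : set (R * R) :=
  [set p | r <= edist p O <= R'].

Definition area_measure :=
  ((@lebesgue_measure R) \x (@lebesgue_measure R))%E.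

Definition Area (D : set (R * R)) : R := fine (area_measure D).

Definition Avg_area (f : R * R -> R) (D : set (R * R)) : R :=
  (Area D)^-1 * Rintegral area_measure D f.

Definition circ (O : R * R) (s t : R) : R * R :=
  (O.1 + s * cos t, O.2 + s * sin t).

(* average over the circle w.r.t. arc length: (1/(2 pi s)) \int_{C(s)} f ds,
   with ds = |gamma'(t)| dt = s dt for gamma = circ O s on [0, 2 pi] *)
Definition Avg_circle (f : R * R -> R) (O : R * R) (s : R) : R :=
  (2 * pi * s)^-1 *
    Rintegral (@lebesgue_measure R) `[0, 2 * pi]%classic
      (fun t => f (circ O s t) * s).

End Defs.

(* Main.v *)
(* Let M(s) be the average of f over C(s). Rotations preserve area, so averaging
   the integral of f over D under all rotations about O (Fubini) replaces f by
   the radial function M(|p - O|), without polar coordinates. For r < x < R,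
   convexity of f on rays bounds M above by its piecewise linear interpolant at
   r, x, R, whose integral over D follows from the fact that the disk of radius s
   has area proportional to s^2. With a, b = (2r+R)/3, (r+2R)/3, the theorem is the
   convex combination of the bounds for x = b, for x = a and for the chord from r
   to R, with weights 3R/(4r+5R), 3r/(5r+4R) and the remainder. *)
Require Import Defs.
From HB Require Import structures.
From mathcomp Require Import all_boot all_order all_algebra.
From mathcomp Require Import all_classical all_reals all_analysis.
From mathcomp Require Import measurable_realfun ring lra.
Set Implicit Arguments.
Unset Strict Implicit.
Unset Printing Implicit Defensive.
Import Order.TTheory GRing.Theory Num.Theory.
Import numFieldNormedType.Exports.
Local Open Scope classical_set_scope.
Local Open Scope ring_scope.

(** * Change of variables under measure-preserving maps *)

Section measure_preserving.
Local Open Scope ereal_scope.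
Context d (T : measurableType d) (R : realType) (mu : {measure set T -> \bar R}).
Variable phi : T -> T.
Hypotheses (mphi : measurable_fun setT phi)
  (mu_phi : forall A, measurable A -> mu (phi @^-1` A) = mu A).

Lemma ge0_integral_preserved (D : set T) (f : T -> \bar R) : measurable D ->
  measurable_fun D f -> {in D, forall x, 0 <= f x} ->
  \int[mu]_(x in phi @^-1` D) f (phi x) = \int[mu]_(x in D) f x.
Proof.
move=> mD mf f0; rewrite -(ge0_integral_pushforward mphi)//.
by apply: eq_measure_integral => A mA _; exact: mu_phi.
Qed.

Let comp_funepos (f : T -> \bar R) : (fun x => f^\+ (phi x)) = (f \o phi)^\+.
Proof. exact/esym/funepos_comp. Qed.

Let comp_funeneg (f : T -> \bar R) : (fun x => f^\- (phi x)) = (f \o phi)^\-.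
Proof. exact/esym/funeneg_comp. Qed.

(** Taking positive and negative parts commutes with composition by [phi], so the nonnegative case
    applies to each part. *)
Lemma integral_preserved (D : set T) (f : T -> \bar R) : measurable D ->
  measurable_fun D f ->
  \int[mu]_(x in phi @^-1` D) f (phi x) = \int[mu]_(x in D) f x.
Proof.
move=> mD mf; rewrite integralE [RHS]integralE.
rewrite -(ge0_integral_preserved mD (measurable_funepos mf))//.
rewrite -(ge0_integral_preserved mD (measurable_funeneg mf))//.
by rewrite comp_funepos comp_funeneg.
Qed.

Lemma measurable_preimage_preserved (D : set T) : measurable D ->
  measurable (phi @^-1` D).
Proof. by move=> mD; rewrite -[X in measurable X]setTI; exact: mphi. Qed.

Lemma integrable_preserved (D : set T) (f : T -> \bar R) : measurable D ->
  mu.-integrable D f -> mu.-integrable (phi @^-1` D) (f \o phi).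
Proof.
move=> mD /integrableP[mf intf]; apply/integrableP; split.
  apply: (measurable_comp mD) => //; first by move=> _ [x Dx <-].
  exact: measurable_funTS.
rewrite (le_lt_trans _ intf)//.
by rewrite -(ge0_integral_preserved mD)//; exact: measurableT_comp.
Qed.

End measure_preserving.

(** * Lebesgue measure on the line under translation and dilation *)

Section lebesgue_affine.
Context {R : realType}.
Local Notation leb := (@lebesgue_measure R).
Local Notation mR := (measurableTypeR R).

(** Lebesgue measure is determined by its values on the intervals []u, v]], and the pushforward by a
    translation gives them the same length. *)
Lemma lebesgue_measure_shift (c : R) (A : set R) : measurable A ->
  leb ((fun x => x + c) @^-1` A) = leb A.
Proof.
move=> mA; apply/esym.
have mshift : measurable_fun setT ((fun x => x + c) : mR -> mR).
  exact: measurable_funD.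
suff H X : ocitv X ->
    leb X = pushforward leb ((fun x => x + c) : mR -> mR) X.
  exact: (lebesgue_measure_unique (fun X => H X)).
case=> -[u v] _ <- /=.
have -> : pushforward leb ((fun x => x + c) : mR -> mR) `]u, v]%classic =
    leb `]u - c, v - c]%classic.
  congr leb; apply/seteqP; split => x /=;
    by rewrite !in_itv/= ltrBlDr lerBrDr.
by rewrite !lebesgue_measure_itv/= !lte_fin ltrD2r -!EFinD; case: ifP => // _;
  congr EFin; ring.
Qed.

Lemma lebesgue_measure_scale (k : R) (A : set R) : 0 < k -> measurable A ->
  leb A = (k%:E * leb ((fun x => (k * x)%R) @^-1` A))%E.
Proof.
move=> k0 mA.
have mk : measurable_fun setT ((fun x => k * x) : mR -> mR).
  exact: measurable_funM.
(* The rescaled pushforward is packaged with its formula: uniqueness needs a measure, the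
   computation only the formula. *)
have nu : {nu : {measure set mR -> \bar R} |
    forall X, nu X = (k%:E * leb ((fun x => (k * x)%R) @^-1` X))%E}.
  by unshelve eexists (mscale (NngNum (ltW k0))
    (pushforward leb ((fun x => k * x) : mR -> mR))).
case: nu => nu nuE; rewrite -nuE.
apply: lebesgue_measure_unique => // _ [[u v] _ <-] /=; rewrite nuE.
have -> : (fun x => k * x) @^-1` `]u, v]%classic = `]u / k, v / k]%classic.
  apply/seteqP; split => x /=;
    by rewrite !in_itv/= ltr_pdivrMr// ler_pdivlMr// mulrC.
rewrite !lebesgue_measure_itv/= !lte_fin ltr_pM2r ?invr_gt0// -!EFinD.
case: ifP => // _; last by rewrite mule0.
by rewrite -EFinM; congr EFin; field; exact: lt0r_neq0.
Qed.

End lebesgue_affine.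

(** * Area under translations, dilations, shears and rotations *)

Definition rot {R : realType} (a b : R) (p : R * R) : R * R :=
  (a * p.1 - b * p.2, b * p.1 + a * p.2).

Section plane.
Context {R : realType}.
Local Notation leb := (@lebesgue_measure R).
Local Notation mR := (measurableTypeR R).
Local Notation mu := (@area_measure R).
Implicit Types (A : set (mR * mR)) (k : R).

Lemma measurable_translation (q : R * R) : measurable_fun setT
  ((fun p => (p.1 + q.1, p.2 + q.2)) : mR * mR -> mR * mR).
Proof. by apply: measurable_fun_pair; apply: measurable_funD. Qed.

Lemma area_translation (q : R * R) A : measurable A ->
  mu ((fun p => (p.1 + q.1, p.2 + q.2)) @^-1` A) = mu A.
Proof.
move=> mA; apply/esym; set phi := (X in X @^-1` _).
have mphi := measurable_translation q.
suff H (X Y : set mR) : measurable X -> measurable Y ->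
    pushforward (leb \x leb)%E (phi : mR * mR -> mR * mR) (X `*` Y) =
    (leb X * leb Y)%E.
  exact: (product_measure_unique H mA).
move=> mX mY.
rewrite -(lebesgue_measure_shift q.1 mX) -(lebesgue_measure_shift q.2 mY).
rewrite -product_measure1E//; apply: measurable_preimage_preserved => //;
  exact: measurable_funD.
Qed.

Lemma measurable_dilation k : measurable_fun setT
  ((fun p => (k * p.1, k * p.2)) : mR * mR -> mR * mR).
Proof. by apply: measurable_fun_pair; apply: measurable_funM. Qed.

(** A product measure is determined by rectangles, and each side of a rectangle contributes one
    factor [k]. *)
Lemma area_dilation k A : 0 < k -> measurable A ->
  mu A = ((k ^+ 2)%:E * mu ((fun p => (k * p.1, k * p.2)%R) @^-1` A))%E.
Proof.
move=> k0 mA; have mphi := measurable_dilation k.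
have nu : {nu : {measure set (mR * mR) -> \bar R} | forall X, nu X =
    ((k ^+ 2)%:E * mu ((fun p => (k * p.1, k * p.2)%R) @^-1` X))%E}.
  by unshelve eexists (mscale (NngNum (ltW (exprn_gt0 2 k0)))
    (pushforward (leb \x leb)%E
      ((fun p => (k * p.1, k * p.2)) : mR * mR -> mR * mR))).
case: nu => nu nuE; rewrite -nuE.
suff H (X Y : set mR) : measurable X -> measurable Y ->
    nu (X `*` Y) = (leb X * leb Y)%E by exact: product_measure_unique.
move=> mX mY; rewrite nuE.
rewrite (lebesgue_measure_scale k0 mX) (lebesgue_measure_scale k0 mY).
rewrite muleACA -EFinM -expr2; congr (_ * _)%E.
rewrite -product_measure1E//; apply: measurable_preimage_preserved => //;
  exact: measurable_funM.
Qed.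

Let shearv k (p : R * R) : R * R := (p.1, p.2 + k * p.1).
Let shearh k (p : R * R) : R * R := (p.1 + k * p.2, p.2).

Let measurable_shearv k : measurable_fun setT (shearv k : mR * mR -> mR * mR).
Proof.
apply: measurable_fun_pair => //; apply: measurable_funD => //.
exact: measurable_funM.
Qed.

Let measurable_shearh k : measurable_fun setT (shearh k : mR * mR -> mR * mR).
Proof.
apply: measurable_fun_pair => //; apply: measurable_funD => //.
exact: measurable_funM.
Qed.

(** Cavalieri: a vertical shear only translates each vertical section, and area integrates the
    lengths of these sections. *)
Let area_shearv k A : measurable A -> mu (shearv k @^-1` A) = mu A.
Proof.
move=> mA; apply: eq_integral => x _ /=.
rewrite -[RHS](lebesgue_measure_shift (k * x)); last exact: measurable_xsection.
by congr leb; apply/seteqP; split => y /=; rewrite /xsection/= !inE.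
Qed.

(** Slicing horizontally instead of vertically gives the same area; this makes the Cavalieri
    argument available for horizontal shears. *)
Lemma area_measure2E A : measurable A -> mu A = (leb \x^ leb)%E A.
Proof.
move=> mA; apply: product_measure_unique => // X Y mX mY.
by rewrite /= product_measure2E.
Qed.

Let area_shearh k A : measurable A -> mu (shearh k @^-1` A) = mu A.
Proof.
move=> mA; have mkA : measurable (shearh k @^-1` A : set (mR * mR)).
  by have := measurable_preimage_preserved (measurable_shearh k) mA.
rewrite (area_measure2E mA) (area_measure2E mkA).
apply: eq_integral => y _ /=.
rewrite -[RHS](lebesgue_measure_shift (k * y)); last exact: measurable_ysection.
by congr leb; apply/seteqP; split => x /=; rewrite /ysection/= !inE.
Qed.

Lemma measurable_rot (a b : R) :
  measurable_fun setT (rot a b : mR * mR -> mR * mR).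
Proof.
by apply: measurable_fun_pair; [apply: measurable_funB|apply: measurable_funD];
  apply: measurable_funM.
Qed.

(* A rotation other than the half-turn is a product of three shears, and the
   half-turn is the square of a quarter-turn. *)
Lemma area_rot (a b : R) A : a ^+ 2 + b ^+ 2 = 1 -> measurable A ->
  mu (rot a b @^-1` A) = mu A.
Proof.
have gen (a' b' : R) B : a' ^+ 2 + b' ^+ 2 = 1 -> a' != -1 -> measurable B ->
    mu (rot a' b' @^-1` B) = mu B.
  move=> ab aN1 mB; have a0 : 1 + a' != 0 by rewrite addrC addr_eq0.
  (* If [a'] and [b'] are the cosine and sine of w, this is - tan (w / 2). *)
  set t := - (b' / (1 + a')).
  have -> : rot a' b' = shearh t \o shearv b' \o shearh t.
    apply/funext => -[x y].
    rewrite /rot /shearh /shearv /t /=; have b2 : b' ^+ 2 = 1 - a' ^+ 2 by lra.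
    congr pair.
      transitivity (x * (1 - b' ^+ 2 / (1 + a')) -
        y * (b' / (1 + a')) * (2 - b' ^+ 2 / (1 + a'))); last by field.
      by rewrite b2; field.
    transitivity (b' * x + y * (1 - b' ^+ 2 / (1 + a'))); last by field.
    by rewrite b2; field.
  have m1 : measurable (shearh t @^-1` B : set (mR * mR)).
    by have := measurable_preimage_preserved (measurable_shearh t) mB.
  have m2 : measurable (shearv b' @^-1` (shearh t @^-1` B) : set (mR * mR)).
    by have := measurable_preimage_preserved (measurable_shearv b') m1.
  by rewrite !comp_preimage (area_shearh t m2) (area_shearv b' m1); exact: area_shearh.
move=> ab mA; have [aE|] := eqVneq a (-1); last by move=> ?; exact: gen.
have -> : rot a b = rot 0 1 \o rot 0 1.
  apply/funext => -[x y].
  have b0 : b = 0 by apply/eqP; rewrite -sqrf_eq0; apply/eqP; nra.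
  by rewrite /rot/= aE b0; congr pair; ring.
have e : (0 : R) ^+ 2 + 1 ^+ 2 = 1 by ring.
have n : (0 : R) != -1 by rewrite eq_sym oppr_eq0 oner_eq0.
have mrA : measurable (rot 0 1 @^-1` A : set (mR * mR)).
  by have := measurable_preimage_preserved (measurable_rot 0 1) mA.
by rewrite comp_preimage (gen _ _ _ e n mrA); exact: gen.
Qed.

End plane.

(** * Area of disks and rings about the origin *)

Definition norm2 {R : realType} (p : R * R) : R :=
  Num.sqrt (p.1 ^+ 2 + p.2 ^+ 2).

Definition ring_set {R : realType} (r v : R) : set (R * R) :=
  [set p | r <= norm2 p <= v].

Section disk_area.
Context {R : realType}.
Local Notation leb := (@lebesgue_measure R).
Local Notation mR := (measurableTypeR R).
Local Notation mu := (@area_measure R).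
Implicit Types (p : R * R) (k s r v : R).

Lemma norm2M k p : 0 <= k -> norm2 (k * p.1, k * p.2) = k * norm2 p.
Proof.
move=> k0; rewrite /norm2/= !exprMn -mulrDr sqrtrM ?sqr_ge0//.
by rewrite sqrtr_sqr ger0_norm.
Qed.

Lemma norm2_rot (a b : R) p : a ^+ 2 + b ^+ 2 = 1 ->
  norm2 (rot a b p) = norm2 p.
Proof.
move=> ab; rewrite /norm2/=; congr Num.sqrt.
transitivity ((a ^+ 2 + b ^+ 2) * (p.1 ^+ 2 + p.2 ^+ 2)); first by ring.
by rewrite ab mul1r.
Qed.

Lemma norm2_circ s t : 0 <= s -> norm2 (circ (0, 0) s t) = s.
Proof.
move=> s0; rewrite /norm2/= !add0r !exprMn -mulrDr cos2Dsin2 mulr1.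
by rewrite sqrtr_sqr ger0_norm.
Qed.

Lemma measurable_norm2 :
  measurable_fun setT (norm2 : mR * mR -> mR).
Proof.
have msqr : measurable_fun setT
    ((fun p => p.1 ^+ 2 + p.2 ^+ 2) : mR * mR -> mR).
  by apply: measurable_funD; apply: measurable_funX.
apply: measurableT_comp msqr.
by apply: continuous_measurable_fun; exact: sqrt_continuous.
Qed.

Let disk s : set (mR * mR) := [set p | norm2 p <= s].
Let odisk s : set (mR * mR) := [set p | norm2 p < s].

Let measurable_disk s : measurable (disk s).
Proof.
rewrite -[disk s]setTI.
rewrite (_ : disk s = norm2 @^-1` `]-oo, s]%classic).
  exact: measurable_norm2.
by rewrite set_itvE.
Qed.

Let measurable_odisk s : measurable (odisk s).
Proof.
rewrite -[odisk s]setTI.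
rewrite (_ : odisk s = norm2 @^-1` `]-oo, s[%classic).
  exact: measurable_norm2.
by rewrite set_itvE.
Qed.

Lemma measurable_ring_set r v : measurable (ring_set r v : set (mR * mR)).
Proof.
rewrite -[ring_set r v]setTI.
rewrite (_ : ring_set r v = norm2 @^-1` `[r, v]%classic).
  exact: measurable_norm2.
by apply/seteqP; split => p; rewrite /ring_set/= in_itv.
Qed.

Lemma area_rectangle (X Y : set mR) : measurable X -> measurable Y ->
  mu (X `*` Y) = (leb X * leb Y)%E.
Proof. exact: product_measure1E. Qed.

Let disk_fin : mu (disk 1) \is a fin_num.
Proof.
rewrite ge0_fin_numE//.
(* The unit disk lies in the square of side 2. *)
apply: (@le_lt_trans _ _ (mu (`[-1, 1]%classic `*` `[-1, 1]%classic))).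
  apply: le_measure; rewrite ?inE//; first exact: measurableX.
  move=> p; rewrite /disk/= /norm2 => p1.
  have : p.1 ^+ 2 + p.2 ^+ 2 <= 1.
    by rewrite -[X in X <= _]sqr_sqrtr ?addr_ge0 ?sqr_ge0// expr_le1.
  move=> h; rewrite !in_itv/=; split; apply/andP; split; nra.
rewrite area_rectangle// !lebesgue_measure_itv/=.
by rewrite lte_fin ltrNl; case: ifP => _; rewrite -?EFinD -?EFinM ?mule0 ltry.
Qed.

(** The area of the unit disk stays symbolic: it cancels when the integral over the annulus is
    divided by the area. *)
Let c := fine (mu (disk 1)).

Lemma disk_gt0 : 0 < c.
Proof.
rewrite fine_gt0//; rewrite -ge0_fin_numE// disk_fin andbT.
apply: (@lt_le_trans _ _ (mu (`[0, 1/2]%classic `*` `[0, 1/2]%classic))).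
  rewrite area_rectangle// !lebesgue_measure_itv/=.
  by rewrite lte_fin ifT ?divr_gt0// -?EFinD -?EFinM lte_fin; nra.
apply: le_measure; rewrite ?inE//; first exact: measurableX.
move=> p [] /=; rewrite !in_itv/= => /andP[a1 a2] /andP[b1 b2].
by rewrite /disk/= /norm2 -sqrtr1 ler_wsqrtr//; nra.
Qed.

Let diskE s : 0 < s -> mu (disk s) = (s ^+ 2 * c)%:E.
Proof.
move=> s0; rewrite (area_dilation s0)// (_ : _ @^-1` _ = disk 1).
  by rewrite [RHS]EFinM /c fineK.
by apply/seteqP; split => p; rewrite /disk/= norm2M ?(ltW s0)//;
  rewrite -ler_pdivlMl// mulVf// lt0r_neq0.
Qed.

Let odisk_fin : mu (odisk 1) \is a fin_num.
Proof.
move: disk_fin; rewrite !ge0_fin_numE//; apply: le_lt_trans.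
by apply: le_measure; rewrite ?inE// => p /ltW.
Qed.

(** The unit circle is null by scaling alone: if the open disk had area c' < c, some closed disk of
    radius s < 1 would have area above c' while lying inside the open disk. *)
Let c_open : mu (odisk 1) = c%:E.
Proof.
rewrite -(fineK odisk_fin); congr EFin.
set c' := fine _; apply/eqP; rewrite eq_le; apply/andP; split.
  apply: fine_le => //.
  by apply: le_measure; rewrite ?inE// => p /ltW.
rewrite leNgt; apply/negP => c'c; have c0 := disk_gt0.
have c'0 : 0 <= c' by exact: fine_ge0.
(* The arithmetic mean of 1 and c' / c; its square exceeds c' / c when c' < c. *)
pose s := (c + c') / (2 * c).
have s0 : 0 < s by rewrite divr_gt0// ?mulr_gt0//; lra.
have s1 : s < 1 by rewrite ltr_pdivrMr ?mulr_gt0//; lra.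
have : s ^+ 2 * c <= c'.
  rewrite -lee_fin -diskE// /c' (fineK odisk_fin).
  by apply: le_measure; rewrite ?inE// => p /= /le_lt_trans; exact.
have -> : s ^+ 2 * c = (c + c') ^+ 2 / (4 * c).
  by rewrite /s; field; exact: lt0r_neq0.
rewrite ler_pdivrMr ?mulr_gt0//; nra.
Qed.

Let odiskE s : 0 < s -> mu (odisk s) = (s ^+ 2 * c)%:E.
Proof.
move=> s0; rewrite (area_dilation s0)// (_ : _ @^-1` _ = odisk 1).
  by rewrite c_open [RHS]EFinM.
by apply/seteqP; split => p; rewrite /odisk/= norm2M ?(ltW s0)//;
  rewrite -ltr_pdivlMl// mulVf// lt0r_neq0.
Qed.

Lemma area_ring_set_disk r v : 0 < r -> r <= v ->
  mu (ring_set r v) = (c * (v ^+ 2 - r ^+ 2))%:E.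
Proof.
move=> r0 rv; have v0 : 0 < v by exact: lt_le_trans rv.
rewrite (_ : ring_set r v = disk v `\` odisk r).
  have -> : mu (disk v `\` odisk r) = (mu (disk v) - mu (odisk r))%E.
    rewrite [LHS]measureD//; last by rewrite [X in (X < _)%E]diskE// ltry.
    by rewrite setIidr// => p /ltW /le_trans; exact.
  by rewrite diskE// odiskE// -EFinB; congr EFin; ring.
apply/seteqP; split => p; rewrite /ring_set /disk /odisk/=.
  by move=> /andP[rp pv]; split => //; apply/negP; rewrite -leNgt.
by move=> [pv /negP]; rewrite -leNgt => ->.
Qed.

Lemma area_ring_set : exists2 c : R, 0 < c & forall r v, 0 < r -> r <= v ->
  mu (ring_set r v) = (c * (v ^+ 2 - r ^+ 2))%:E.
Proof. by exists c; [exact: disk_gt0|exact: area_ring_set_disk]. Qed.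

End disk_area.

(** Required to exchange integration over the plane with integration over a radius or an angle; the
    squares of side 2n exhaust the plane. *)
Lemma area_sigma_finite {R : realType} : sigma_finite setT (@area_measure R).
Proof.
exists (fun n : nat => `[- n%:R, n%:R]%classic `*` `[- n%:R, n%:R]%classic).
  apply/esym; rewrite -subTset => -[x y] _.
  exists (Num.truncn (`|x| + `|y|)).+1 => //.
  have := truncnS_gt (`|x| + `|y|); set n := _.+1 => h.
  by split => /=; rewrite in_itv/= -ler_norml; apply: ltW; apply: le_lt_trans h;
    rewrite ?lerDl ?lerDr.
move=> k; split; first exact: measurableX.
rewrite area_rectangle// !lebesgue_measure_itv/=.
by case: ifP => _; rewrite ?mule0// -EFinD -EFinM ltry.
Qed.

HB.instance Definition _ (R : realType) := Measure.on (@area_measure R).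
HB.instance Definition _ (R : realType) :=
  Measure_isSigmaFinite.Build _ _ _ (@area_measure R) area_sigma_finite.

(** * Integral of a truncated cone over a ring *)

Section truncated_cone.
Context {R : realType}.
Local Notation leb := (@lebesgue_measure R).
Local Notation mR := (measurableTypeR R).
Local Notation mu := (@area_measure R).

Lemma integral_sqr_sub (c r u : R) : r < u ->
  (\int[leb]_(v in `[r, u]) (c * (v ^+ 2 - r ^+ 2))%:E)%E =
  (c * ((u - r) ^+ 2 * (u + 2 * r) / 3))%:E.
Proof.
move=> ru; pose F (v : R) := c * (3^-1 * v ^+ 3 - r ^+ 2 * v).
have dF (v : R) : is_derive v 1 F (c * (v ^+ 2 - r ^+ 2)).
  by rewrite /F; apply: is_derive_eq; rewrite /GRing.scale/=; field.
have cF : continuous F.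
  move=> x; apply: differentiable_continuous; apply/derivable1_diffP.
  by have [] := dF x.
rewrite (@continuous_FTC2 _ _ F _ _ ru).
- by rewrite -EFinB /F; congr EFin; field.
- apply: continuous_subspaceT => v; apply: cvgMr; apply: cvgB; last exact: cvg_cst.
  exact: exprn_continuous.
- split; first by move=> v _; have [] := dF v.
  + exact/cvg_at_right_filter/cF.
  + exact/cvg_at_left_filter/cF.
- by move=> v _; rewrite derive1E; have [_ ->] := dF v.
Qed.

(* Layer cake: [(u - norm2 p)^+] is the length of [norm2 p <= v <= u]. *)
Lemma integral_cone (c r R' u : R) :
  (forall r' v : R, 0 < r' -> r' <= v ->
    mu (ring_set r' v) = (c * (v ^+ 2 - r' ^+ 2))%:E) ->
  0 < r -> r < u -> u <= R' ->
  (\int[mu]_(p in ring_set r R') (Num.max (u - norm2 p) 0)%:E)%E =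
  (c * ((u - r) ^+ 2 * (u + 2 * r) / 3))%:E.
Proof.
move=> ringE r0 ru uR.
(* For fixed [p] in the ring the slice is the interval from [norm2 p] to [u], empty if
   [norm2 p > u]; for fixed [v] it is the ring of radii [r] and [v]. Tonelli equates the two ways of
   measuring [S]. *)
pose S : set (mR * (mR * mR)) :=
  [set z | z.1 \in `[r, u] /\ r <= norm2 z.2 <= z.1].
have mS : measurable S.
  have m1 : measurable_fun setT (fun z : mR * (mR * mR) => z.1 : mR).
    exact: measurable_fst.
  have m2 : measurable_fun setT (fun z : mR * (mR * mR) => norm2 z.2 : mR).
    by apply: measurableT_comp => //; exact: measurable_norm2.
  have -> : S = ((fun z => z.1) @^-1` `[r, u]%classic) `&`
      (((fun z => norm2 z.2) @^-1` `[r, +oo[%classic) `&`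
       ((fun z => z.1 - norm2 z.2) @^-1` `[0, +oo[%classic)).
    apply/seteqP; split => -[v p]; rewrite /S/= !in_itv/= !andbT subr_ge0.
      by move=> [? /andP[]].
    by move=> [-> [-> ->]].
  apply: measurableI; last apply: measurableI; rewrite -[X in measurable X]setTI.
  - exact: m1.
  - exact: m2.
  - by apply: (measurable_funB m1 m2).
have := @indic_fubini_tonelli _ _ mR (mR * mR)%type R leb mu S mS.
rewrite indic_fubini_tonelli_FE// indic_fubini_tonelli_GE// => fub.
transitivity (\int[mu]_p (leb \o ysection S) p)%E.
  rewrite integral_mkcond; apply: eq_integral => p _; rewrite patchE /=.
  case: ifPn; rewrite (inE, notin_setE) /ring_set/= => pD.
    move: pD => /andP[rp pR].
    rewrite (_ : ysection S p = `[norm2 p, u]%classic).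
      rewrite lebesgue_measure_itv/= lte_fin; case: ltP => pu.
        by rewrite -EFinB; congr EFin; apply/max_idPl; rewrite subr_ge0 ltW.
      by congr EFin; apply/max_idPr; rewrite subr_le0.
    apply/seteqP; split => v; rewrite /ysection/= inE /S/= !in_itv/=.
      by move=> [/andP[_ ->] /andP[_ ->]].
    by move=> /andP[pv vu]; rewrite rp pv vu (le_trans rp pv).
  rewrite (_ : ysection S p = set0) ?measure0//.
  apply/seteqP; split => v //; rewrite /ysection/= inE /S/= !in_itv/=.
  move=> [/andP[_ vu] /andP[rp pv]]; apply: pD.
  by rewrite rp (le_trans pv)// (le_trans vu).
rewrite [LHS](esym fub) -integral_sqr_sub// [RHS]integral_mkcond.
apply: eq_integral => v _; rewrite patchE /=; case: ifPn.
  rewrite inE/= in_itv/= => /andP[rv vu]; rewrite -ringE//.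
  congr mu; apply/seteqP; split => p; rewrite /xsection/= inE /S/= in_itv/= rv vu.
    by case.
  by move=> ?; split.
rewrite notin_setE/= => vN; rewrite (_ : xsection S v = set0) ?measure0//.
by apply/seteqP; split => p //; rewrite /xsection/= inE => -[/=].
Qed.

End truncated_cone.

(** Positive parts grow and negative parts shrink from [f] to [g]. Measurability is the hypothesis
    because on a circle of arbitrary radius the integrand is only known to be measurable. *)
Lemma le_integral_upper d (T : measurableType d) (R : realType)
    (nu : {measure set T -> \bar R}) (D : set T) (f g : T -> \bar R) :
  measurable D -> measurable_fun D f -> measurable_fun D g ->
  (forall x, D x -> (f x <= g x)%E) ->
  (\int[nu]_(x in D) f x <= \int[nu]_(x in D) g x)%E.
Proof.
move=> mD mf mg fg; rewrite integralE [leRHS]integralE; apply: leeB.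
  apply: ge0_le_integral => //; try exact: measurable_funepos.
  by move=> x Dx; rewrite !funeposE ge_max le_max (fg x Dx) le_max lexx orbT.
apply: ge0_le_integral => //; try exact: measurable_funeneg.
by move=> x Dx; rewrite !funenegE ge_max !le_max leeN2 (fg x Dx) lexx orbT.
Qed.

(** * Periodic integrands and polar angles *)

Section periodic.
Context {R : realType}.
Local Notation leb := (@lebesgue_measure R).
Local Notation mR := (measurableTypeR R).

(** Cut [[0, T]] at [T - b]: translation by [b] carries the first piece to [[b, T]], and translation
    by [b - T], harmless by periodicity, carries the second to []0, b]]. *)
Lemma integral_period_shift (g : R -> \bar R) (T b : R) : 0 <= b <= T ->
  (forall t, g (t + T) = g t) -> measurable_fun `[0, T] g ->
  measurable_fun `[0, T] (fun t => g (t + b)) /\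
  (\int[leb]_(t in `[0%R, T]) g (t + b)%R = \int[leb]_(t in `[0%R, T]) g t)%E.
Proof.
move=> /andP[b0 bT] gT mg.
have mshift (c : R) : measurable_fun setT ((fun x => x + c) : mR -> mR).
  exact: measurable_funD.
have sub (x y : R) b1 : 0 <= x -> y <= T ->
    [set` Interval (BSide b1 x) (BRight y)] `<=` `[0, T].
  by move=> x0 yT; apply: subset_itv; rewrite bnd_simp//; case: b1.
have split (h : R -> \bar R) (c : R) : 0 <= c <= T -> measurable_fun `[0, T] h ->
    (\int[leb]_(t in `[0%R, T]) h t =
     \int[leb]_(t in `[0%R, c]) h t + \int[leb]_(t in `]c, T]) h t)%E.
  move=> /andP[c0 cT] mh; rewrite -integral_setU//.
  - by rewrite -itv_bndbnd_setU// bnd_simp.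
  - by rewrite -itv_bndbnd_setU// bnd_simp.
  - apply/disj_setPS => y [/=]; rewrite 2!in_itv/= => /andP[_ yx] /andP[].
    by rewrite ltNge yx.
have pre1 : (fun t => t + b) @^-1` `[b, T]%classic = `[0, T - b]%classic.
  by apply/seteqP; split => t; rewrite /= !in_itv/= lerDr lerBrDr.
have pre2 : (fun t => t + (b - T)) @^-1` `]0, b]%classic = `]T - b, T]%classic.
  apply/seteqP; split => t; rewrite /= !in_itv/= => /andP[? ?];
    by apply/andP; split; lra.
have gbT t : g (t + (b - T)) = g (t + b).
  by rewrite -gT; congr g; ring.
have m1 : measurable_fun `[0, T - b] (fun t => g (t + b)).
  rewrite -pre1; apply: (measurable_comp (F := `[b, T]%classic)) => //.
  - by move=> _ [t tb <-]; exact: tb.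
  - by apply: measurable_funS mg => //; exact: sub.
  - exact: measurable_funTS (mshift b).
have m2 : measurable_fun `]T - b, T] (fun t => g (t + b)).
  rewrite -pre2 (_ : (fun t => _) = g \o (fun t => t + (b - T))); last first.
    by apply/funext => t /=; rewrite gbT.
  apply: (measurable_comp (F := `]0, b]%classic)) => //.
  - by move=> _ [t tb <-]; exact: tb.
  - by apply: measurable_funS mg => //; exact: sub.
  - exact: measurable_funTS (mshift (b - T)).
have mgb : measurable_fun `[0, T] (fun t => g (t + b)).
  rewrite (@itv_bndbnd_setU _ _ _ (BRight (T - b))) ?bnd_simp; [|lra..].
  by rewrite measurable_funU.
split => //.
rewrite (split _ (T - b)) ?(split g b) ?b0//; last by apply/andP; split; lra.
rewrite addeC; congr (_ + _)%E.
  (* Cutting at [b] yields [[0, b]] and []b, T]], while the translated pieces are []0, b]] and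
     [[b, T]]; the endpoints are null. *)
  rewrite -integral_itv_obnd_cbnd; last first.
    by apply: measurable_funS mg => //; exact: sub.
  rewrite -pre2; under eq_integral do rewrite -gbT.
  apply: (integral_preserved (mshift (b - T))) => //.
    by move=> A mA; exact: lebesgue_measure_shift.
  by apply: measurable_funS mg => //; exact: sub.
rewrite integral_itv_obnd_cbnd; last first.
  by apply: measurable_funS mg => //; exact: sub.
rewrite -pre1; apply: (integral_preserved (mshift b)) => //.
  by move=> A mA; exact: lebesgue_measure_shift.
by apply: measurable_funS mg => //; exact: sub.
Qed.

(** The arccosine of x / s is the angle in the closed upper half-plane; its reflection
    [pi *+ 2 - acos (x / s)] serves below the axis. *)
Lemma polar_angle (p : R * R) : 0 < norm2 p ->
  exists2 b, 0 <= b <= 2 * pi & p = circ (0, 0) (norm2 p) b.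
Proof.
case: p => x y; set s := norm2 _ => s0.
have s2 : x ^+ 2 + y ^+ 2 = s ^+ 2.
  by rewrite /s sqr_sqrtr// addr_ge0 ?sqr_ge0.
have xs : -1 <= x / s <= 1.
  by rewrite ler_pdivrMr// ler_pdivlMr//; apply/andP; split; nra.
have sE : s * sin (acos (x / s)) = `|y|.
  rewrite sin_acos// -[s in s * _]ger0_norm ?ltW// -sqrtr_sqr -sqrtrM ?sqr_ge0//.
  rewrite -[RHS]sqrtr_sqr; congr Num.sqrt.
  have -> : y ^+ 2 = s ^+ 2 - x ^+ 2 by rewrite -s2; ring.
  by field; exact: lt0r_neq0.
have cE : s * (x / s) = x by field; exact: lt0r_neq0.
have := acos_ge0 xs; have := acos_lepi xs; have pi0 := pi_gt0 R.
have xI : x / s \in `[(-1), 1] by rewrite in_itv.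
have [y0|y0] := leP 0 y => api a0.
  exists (acos (x / s)); first by apply/andP; split => //; lra.
  rewrite /circ/= !add0r acosK//; congr pair; first exact/esym/cE.
  by rewrite -[LHS]ger0_norm//; exact/esym/sE.
exists (pi *+ 2 - acos (x / s)).
  by rewrite -mulr_natl; apply/andP; split; lra.
rewrite /circ/= !add0r cosB sinB cos2pi sin2pi acosK//.
rewrite mul1r !mul0r addr0 sub0r; congr pair; first exact/esym/cE.
have yE : y = - `|y| by rewrite ltr0_norm// opprK.
rewrite mul1r mulrN [LHS]yE; congr (- _); exact/esym/sE.
Qed.

End periodic.

(** * Averaging over all rotations by Fubini *)

Section rotation_average.
Context {R : realType}.
Local Notation leb := (@lebesgue_measure R).
Local Notation mR := (measurableTypeR R).
Local Notation mu := (@area_measure R).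

Lemma measurable_rot_angle : measurable_fun setT
  ((fun z => rot (cos z.2) (sin z.2) z.1) : (mR * mR) * mR -> mR * mR).
Proof.
have mcos : measurable_fun setT (fun z : (mR * mR) * mR => cos z.2 : mR).
  apply: measurableT_comp => //.
  by apply: continuous_measurable_fun; exact: continuous_cos.
have msin : measurable_fun setT (fun z : (mR * mR) * mR => sin z.2 : mR).
  apply: measurableT_comp => //.
  by apply: continuous_measurable_fun; exact: continuous_sin.
have mx : measurable_fun setT (fun z : (mR * mR) * mR => z.1.1 : mR).
  by apply: measurableT_comp.
have my : measurable_fun setT (fun z : (mR * mR) * mR => z.1.2 : mR).
  by apply: measurableT_comp.
by apply: measurable_fun_pair; [apply: measurable_funB|apply: measurable_funD];
  apply: measurable_funM.
Qed.

Lemma rot_circ s a b :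
  rot (cos a) (sin a) (circ (0, 0) s b) = circ (0 : R, 0) s (a + b).
Proof. by rewrite /rot /circ/= cosD sinD !add0r; congr pair; ring. Qed.

Lemma circ_period s t : circ (0 : R, 0) s (t + 2 * pi) = circ (0, 0) s t.
Proof. by rewrite /circ mulr_natl cosD2pi sinD2pi. Qed.

(** This is 2 pi times the mean of [h] over the circle through [p]. It takes extended real values
    because integrability over the ring does not control each single circle. *)
Definition rotation_mean (h : R * R -> R) (p : R * R) : \bar R :=
  (\int[leb]_(a in `[0%R, (2 * pi)%R]) (h (rot (cos a) (sin a) p))%:E)%E.

Variables (r R' : R) (h : R * R -> R).
Let D : set (mR * mR) := ring_set r R'.
Let I : set mR := `[0, 2 * pi]%classic.
Hypothesis ih : mu.-integrable D (EFin \o h).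

Let mD : measurable D. Proof. exact: measurable_ring_set. Qed.
Let mI : measurable I. Proof. exact: measurable_itv. Qed.

(** Extension by zero is measurable on the whole plane and compatible with rotations, which preserve
    [D]. *)
Let hD := (EFin \o h) \_ D.

Let mhD : measurable_fun setT hD.
Proof. exact: (measurable_restrictT (EFin \o h) mD).1 (measurable_int mu ih). Qed.

Let rotE a p : D (rot (cos a) (sin a) p) = D p.
Proof. by rewrite /D /ring_set/= norm2_rot// cos2Dsin2. Qed.

Let hD_rot a p : hD (rot (cos a) (sin a) p) =
  ((fun p => (h (rot (cos a) (sin a) p))%:E) \_ D) p.
Proof.
rewrite /hD !patchE; have [Dp|Dp] := pselect (D p).
  by rewrite !mem_set// rotE.
by rewrite !memNset// rotE.
Qed.

(** The ring and the angle interval are both absorbed into the integrand, so that Fubini runs over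
    the whole product space. *)
Let F (z : (mR * mR) * mR) : \bar R :=
  ((\1_I z.2)%:E * hD (rot (cos z.2) (sin z.2) z.1))%E.

Let mF : measurable_fun setT F.
Proof.
apply: emeasurable_funM; last first.
  by apply: measurableT_comp => //; exact: measurable_rot_angle.
apply/measurable_EFinP; apply: measurableT_comp => //.
Qed.

Let integral_hD_rot a :
  (\int[mu]_p hD (rot (cos a) (sin a) p) = \int[mu]_(p in D) (h p)%:E)%E.
Proof.
rewrite [RHS]integral_mkcond -/hD.
apply: (integral_preserved (measurable_rot (cos a) (sin a))) => // A mA.
by apply: area_rot => //; exact: cos2Dsin2.
Qed.

Let integral_abs_hD_rot a :
  (\int[mu]_p `|hD (rot (cos a) (sin a) p)| = \int[mu]_(p in D) `|(h p)%:E|)%E.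
Proof.
rewrite [RHS]integral_mkcond.
rewrite (_ : _ \_ D = abse \o hD); last first.
  by apply/funext => p; rewrite /hD /= !patchE; case: ifP => //; rewrite abse0.
apply: (integral_preserved (measurable_rot (cos a) (sin a))) => // [A mA|].
  by apply: area_rot => //; exact: cos2Dsin2.
exact: measurableT_comp.
Qed.

Let measI : leb I = (2 * pi)%:E.
Proof.
rewrite lebesgue_measure_itv/= lte_fin mulr_gt0// ?pi_gt0//.
by rewrite -EFinB subr0.
Qed.

Let integral_indicI : (\int[leb]_a (\1_I a)%:E = (2 * pi)%:E)%E.
Proof. by rewrite integral_indic// setIT; exact: measI. Qed.

(** Integrating over the plane first, every angle in [I] contributes the same finite integral of |h|
    over [D], by rotation invariance; the total is that integral times 2 pi. *)
Let iF : (mu \x leb)%E.-integrable setT F.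
Proof.
apply: (@integrable21ltyP _ _ (mR * mR)%type mR R mu leb F mF).2.
rewrite (_ : (fun a => _) = (fun a =>
    (\1_I a)%:E * \int[mu]_(p in D) `|(h p)%:E|)%E); last first.
  apply/funext => a; rewrite -(integral_abs_hD_rot a).
  rewrite -ge0_integralZl//.
  - by apply: eq_integral => p _; rewrite /F/= abseM gee0_abs// lee_fin.
  - do 2 apply: measurableT_comp => //; exact: measurable_rot.
rewrite ge0_integralZr//; last exact: integral_ge0.
rewrite integral_indicI lte_mul_pinfty//.
- by rewrite lee_fin mulr_ge0// pi_ge0.
- by have /integrableP[] := ih.
- exact/measurable_EFinP/measurable_indic.
Qed.

Let fubini_mean p : (\int[leb]_a F (p, a) = (rotation_mean h \_ D) p)%E.
Proof.
rewrite patchE; case: ifPn => [|pD].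
  move=> pD; rewrite /rotation_mean [RHS]integral_mkcond.
  apply: eq_integral => a _; rewrite /F/= hD_rot !patchE pD indicE.
  by case: (a \in _); rewrite ?mul1e ?mul0e.
transitivity (0%E : \bar R) => //; apply: integral0_eq => a _.
rewrite /F/= hD_rot patchE (negbTE pD).
by rewrite [X in (_ * X)%E](_ : _ = 0%E)// mule0.
Qed.

Lemma integrable_rotation_mean : mu.-integrable D (rotation_mean h).
Proof.
apply/(integrable_mkcond _ mD).
have := integrable_fubini_F iF.
by apply: eq_integrable => // p _; exact: fubini_mean.
Qed.

(** Fubini: integration over angles first gives the rotation mean, and over the plane first gives
    the integral of [h] over [D] for each angle. *)
Lemma integral_rotation_mean :
  (\int[mu]_(p in D) rotation_mean h p = (2 * pi)%:E * \int[mu]_(p in D) (h p)%:E)%E.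
Proof.
rewrite integral_mkcond; under eq_integral do rewrite -fubini_mean.
rewrite (Fubini iF).
rewrite (_ : (fun a => _) = (fun a =>
    (\1_I a)%:E * \int[mu]_(p in D) (h p)%:E)%E); last first.
  apply/funext => a; rewrite -(integral_hD_rot a).
  rewrite indicE; case aI : (a \in I).
    rewrite mul1e; apply: eq_integral => p _.
    by rewrite /F/= indicE aI mul1e.
  rewrite mul0e; apply: integral0_eq => p _.
  by rewrite /F/= indicE aI mul0e.
have fin : (\int[mu]_(p in D) (h p)%:E)%E \is a fin_num.
  exact: integrable_fin_num.
rewrite -(fineK fin) integralZr//; last first.
  exact: integrable_indic_itv.
by rewrite integral_indicI.
Qed.

(** The circle through [p] stays in [D], so [h] may be replaced there by its measurable extension
    [hD]. *)
Lemma measurable_rotation p : D p ->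
  measurable_fun I (fun a => (h (rot (cos a) (sin a) p))%:E).
Proof.
move=> Dp; apply: measurable_funTS.
rewrite (_ : (fun a => _) = (fun a => hD (rot (cos a) (sin a) p))).
  apply: (measurableT_comp (f := hD)) => //.
  have mp : measurable_fun setT ((fun a => (p, a)) : mR -> (mR * mR) * mR).
    exact: measurable_fun_pair.
  by have := measurableT_comp measurable_rot_angle mp.
by apply/funext => a; rewrite hD_rot patchE mem_set.
Qed.

End rotation_average.

(** * Upper bound from piecewise linear interpolation at three radii *)

Section three_radii.
Context {R : realType}.
Local Notation leb := (@lebesgue_measure R).
Local Notation mR := (measurableTypeR R).
Local Notation mu := (@area_measure R).
Local Notation A h s :=
  (Rintegral leb `[0, 2 * pi]%classic (fun t => h (circ (0, 0) s t))).
Implicit Types h : R * R -> R.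

Lemma measurable_cone (u : R) : measurable_fun setT
  ((fun p => Num.max (u - norm2 p) 0) : mR * mR -> mR).
Proof.
apply: measurable_maxr => //; apply: measurable_funB => //.
exact: measurable_norm2.
Qed.

(** On the ring, every function of [norm2 p] that is continuous and piecewise linear with a single
    knot at [x] has the form [k]. The constant integrates to an area, the other terms by
    [integral_cone]. *)
Lemma Rintegral_cones (c r x R' a b g : R) :
  (forall r' v : R, 0 < r' -> r' <= v ->
    mu (ring_set r' v) = (c * (v ^+ 2 - r' ^+ 2))%:E) ->
  0 < r -> r < x -> x <= R' ->
  let k p := a + b * Num.max (R' - norm2 p) 0 + g * Num.max (x - norm2 p) 0 in
  mu.-integrable (ring_set r R') (EFin \o k) /\
  Rintegral mu (ring_set r R') k =
    c * (a * (R' ^+ 2 - r ^+ 2) + b * ((R' - r) ^+ 2 * (R' + 2 * r) / 3)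
         + g * ((x - r) ^+ 2 * (x + 2 * r) / 3)).
Proof.
move=> ringE r0 rx xR; have rR : r < R' by exact: lt_le_trans xR.
set D := ring_set r R'; have mD : measurable (D : set (mR * mR)).
  exact: measurable_ring_set.
have coneE u : r < u -> u <= R' ->
    mu.-integrable D (EFin \o (fun p => Num.max (u - norm2 p) 0)) /\
    Rintegral mu D (fun p => Num.max (u - norm2 p) 0) =
      c * ((u - r) ^+ 2 * (u + 2 * r) / 3).
  move=> ru uR; have E := integral_cone ringE r0 ru uR.
  split; last by rewrite /Rintegral E.
  apply/integrableP; split.
    by apply/measurable_EFinP; exact: measurable_funTS (measurable_cone u).
  under eq_integral do rewrite gee0_abs ?lee_fin ?le_max ?lexx ?orbT//.
  by rewrite E ltry.
have muD : mu D = (c * (R' ^+ 2 - r ^+ 2))%:E by rewrite ringE// ltW.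
have i1 : mu.-integrable D (EFin \o cst a).
  apply/integrableP; split; first exact/measurable_EFinP.
  have -> : (\int[mu]_(p in D) `|(EFin \o cst a) p| = (`|a|%R)%:E * mu D)%E.
    exact: (integral_cst mu mD (`|a|)%:E).
  by rewrite muD -EFinM ltry.
have [iR ER] := coneE R' rR (lexx _); have [ix Ex] := coneE x rx xR.
have bR : mu.-integrable D (EFin \o (fun p => b * Num.max (R' - norm2 p) 0)).
  by have := integrableZl mD b iR; apply: eq_integrable => // p _.
have gx : mu.-integrable D (EFin \o (fun p => g * Num.max (x - norm2 p) 0)).
  by have := integrableZl mD g ix; apply: eq_integrable => // p _.
have i2 : mu.-integrable D
    (EFin \o (fun p => a + b * Num.max (R' - norm2 p) 0)).
  by have := integrableD mD i1 bR; apply: eq_integrable => // p _.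
move=> k; split.
  by have := integrableD mD i2 gx; apply: eq_integrable => // p _.
rewrite RintegralD// [X in X + _]RintegralD// RintegralZl// RintegralZl// ER Ex.
rewrite Rintegral_cst// -[X in fine X]/(mu D) muD/=; ring.
Qed.

(** With [b] the polar angle of [p], rotation by [a] leads to angle a + b. Integrating the pointwise
    bound over [a] gives circle integrals shifted by [b], and periodicity removes the shift. *)
Lemma rotation_mean_le (h : R * R -> R) (r R' : R) (x1 x2 x3 c1 c2 c3 : R)
    (p : R * R) : 0 < r ->
  mu.-integrable (ring_set r R') (EFin \o h) ->
  (forall s, s \in [:: x1; x2; x3] -> leb.-integrable `[0, 2 * pi]%classic
     (fun t => (h (circ (0, 0) s t))%:E)) ->
  ring_set r R' p ->
  (forall t, h (circ (0, 0) (norm2 p) t) <= c1 * h (circ (0, 0) x1 t) +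
     c2 * h (circ (0, 0) x2 t) + c3 * h (circ (0, 0) x3 t)) ->
  (rotation_mean h p <= (c1 * A h x1 + c2 * A h x2 + c3 * A h x3)%:E)%E.
Proof.
move=> r0 ih ix Dp hle.
have [i1 i2 i3] : [/\ leb.-integrable `[0, 2 * pi]%classic
    (EFin \o (fun t => h (circ (0, 0) x1 t))),
    leb.-integrable `[0, 2 * pi]%classic
    (EFin \o (fun t => h (circ (0, 0) x2 t))) &
    leb.-integrable `[0, 2 * pi]%classic
    (EFin \o (fun t => h (circ (0, 0) x3 t)))].
  by split; apply: ix; rewrite !inE eqxx ?orbT.
have mI : measurable (`[0, 2 * pi]%classic : set mR) by exact: measurable_itv.
have p0 : 0 < norm2 p by have /andP[rp _] := Dp; exact: lt_le_trans rp.
have [b b2pi pE] := polar_angle p0.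
pose g t := c1 * h (circ (0, 0) x1 t) + c2 * h (circ (0, 0) x2 t) +
  c3 * h (circ (0, 0) x3 t).
have iZ (c : R) k : leb.-integrable `[0, 2 * pi]%classic (EFin \o k) ->
    leb.-integrable `[0, 2 * pi]%classic (EFin \o (fun t : mR => c * k t)).
  by move=> ik; have := integrableZl mI c ik; apply: eq_integrable.
have iD k l : leb.-integrable `[0, 2 * pi]%classic (EFin \o k) ->
    leb.-integrable `[0, 2 * pi]%classic (EFin \o l) ->
    leb.-integrable `[0, 2 * pi]%classic (EFin \o (fun t : mR => k t + l t)).
  by move=> ik il; have := integrableD mI ik il; apply: eq_integrable.
have ig : leb.-integrable `[0, 2 * pi]%classic (EFin \o g).
  by apply: (iD); [apply: (iD)|]; exact: iZ.
have -> : c1 * A h x1 + c2 * A h x2 + c3 * A h x3 =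
    Rintegral leb `[0, 2 * pi]%classic g.
  rewrite /g RintegralD//; last 2 first.
  - by apply: (iD); exact: iZ.
  - exact: iZ.
  by rewrite RintegralD ?RintegralZl//; exact: iZ.
rewrite /Rintegral fineK; last exact: integrable_fin_num.
have gT t : (EFin \o g) (t + 2 * pi) = (EFin \o g) t.
  by rewrite /g/= !circ_period.
have [mgb <-] := integral_period_shift b2pi gT (measurable_int leb ig).
apply: le_integral_upper => //; first exact: measurable_rotation ih _ Dp.
by move=> a _; rewrite lee_fin pE rot_circ; exact: hle.
Qed.

(** [A h s] is 2 pi times the mean over the circle of radius [s], whence the factor [2 * pi]. The
    coefficients on the right are the integrals over the ring of the three interpolation weights. *)
Lemma three_radii_bound (c : R) (h : R * R -> R) (r x R' : R) :
  (forall r' v : R, 0 < r' -> r' <= v ->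
    mu (ring_set r' v) = (c * (v ^+ 2 - r' ^+ 2))%:E) ->
  0 < r -> r < x -> x < R' ->
  mu.-integrable (ring_set r R') (EFin \o h) ->
  (forall s, s \in [:: r; x; R'] -> leb.-integrable `[0, 2 * pi]%classic
     (fun t => (h (circ (0, 0) s t))%:E)) ->
  (forall t s1 s2 s3, r <= s1 -> s1 <= s2 -> s2 <= s3 -> s3 <= R' ->
    (s3 - s1) * h (circ (0, 0) s2 t) <=
    (s3 - s2) * h (circ (0, 0) s1 t) + (s2 - s1) * h (circ (0, 0) s3 t)) ->
  2 * pi * Rintegral mu (ring_set r R') h <=
  c / 3 * ((x - r) * (x + 2 * r) * A h r + (R' - r) * (r + x + R') * A h x
           + (R' - x) * (2 * R' + x) * A h R').
Proof.
move=> ringE r0 rx xR ih ia hconv.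
have xr0 : 0 < x - r by rewrite subr_gt0.
have Rx0 : 0 < R' - x by rewrite subr_gt0.
(* As functions of [norm2 p], the weights [c3], [c1], [c2] are the hat functions of the knots [r],
   [x], [R'], written with truncated cones. *)
pose c3 p := Num.max (x - norm2 p) 0 / (x - r).
pose c2 p := (R' - x - Num.max (R' - norm2 p) 0 + Num.max (x - norm2 p) 0) /
  (R' - x).
pose c1 p := 1 - c2 p - c3 p.
pose K p := c3 p * A h r + c1 p * A h x + c2 p * A h R'.
have KE : K = (fun p => A h R'
    + (A h x - A h R') / (R' - x) * Num.max (R' - norm2 p) 0
    + (A h r / (x - r) + A h R' / (R' - x)
       - A h x * (1 / (R' - x) + 1 / (x - r))) * Num.max (x - norm2 p) 0).
  apply/funext => p; rewrite /K /c1 /c2 /c3.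
  by field; rewrite !lt0r_neq0.
have := Rintegral_cones (A h R') ((A h x - A h R') / (R' - x))
  (A h r / (x - r) + A h R' / (R' - x) - A h x * (1 / (R' - x) + 1 / (x - r)))
  ringE r0 rx (ltW xR).
rewrite /= -KE => -[iK IK].
have mD : measurable (ring_set r R' : set (mR * mR)).
  exact: measurable_ring_set.
have hK p : ring_set r R' p -> (rotation_mean h p <= (K p)%:E)%E.
  move=> Dp; apply: (rotation_mean_le r0 ih ia Dp) => t.
  have /andP[rp pR] := Dp.
  have eR : Num.max (R' - norm2 p) 0 = R' - norm2 p.
    by apply/max_idPl; rewrite subr_ge0.
  (* On either side of [x] one outer weight vanishes, and what remains is convexity between the two
     neighbouring knots. *)
  have [px|xp] := leP (norm2 p) x.
    have ex : Num.max (x - norm2 p) 0 = x - norm2 p.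
      by apply/max_idPl; rewrite subr_ge0.
    have := hconv t r (norm2 p) x (lexx _) rp px (ltW xR).
    rewrite -ler_pdivlMl// => /le_trans; apply.
    rewrite /c1 /c2 /c3 ex eR le_eqVlt; apply/orP; left; apply/eqP.
    by field; rewrite !lt0r_neq0.
  have ex : Num.max (x - norm2 p) 0 = 0.
    by apply/max_idPr; rewrite subr_le0 ltW.
  have := hconv t x (norm2 p) R' (ltW rx) (ltW xp) pR (lexx _).
  rewrite -ler_pdivlMl// => /le_trans; apply.
  rewrite /c1 /c2 /c3 ex eR le_eqVlt; apply/orP; left; apply/eqP.
  by field; rewrite !lt0r_neq0.
have := le_integral mD (integrable_rotation_mean ih) iK.
move=> /(_ (fun p Dp => hK p (set_mem Dp))).
rewrite (integral_rotation_mean ih).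
rewrite -(fineK (integrable_fin_num mD ih)) -(fineK (integrable_fin_num mD iK)).
rewrite -EFinM lee_fin => /le_trans; apply.
rewrite [leLHS]IK le_eqVlt; apply/orP; left; apply/eqP.
by field; rewrite !lt0r_neq0.
Qed.

End three_radii.

(** * Combining the bounds at the trisection radii *)

Section convex_combination.
Context {R : realType}.

Lemma convex_function_segment (U : set (R * R)) (f : R * R -> R)
    (p q : R * R) (k : R) :
  convex_function U f -> U p -> U q -> 0 <= k <= 1 ->
  f (k * p.1 + (1 - k) * q.1, k * p.2 + (1 - k) * q.2) <=
  k * f p + (1 - k) * f q.
Proof.
move=> fU Up Uq /andP[k0 k1].
by have := fU (Itv01 k0 k1) p q (mem_set Up) (mem_set Uq).
Qed.

(* The first two bounds are the three-radii bounds at x = (r+2R')/3 and at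
   x = (2r+R')/3. *)
Lemma trisection_mixture (r R' Q Ar Aa Ab AR : R) : 0 < r -> r < R' ->
  Q <= 2 / 9 * (7 * r + 2 * R') * Ar + (4 * r + 5 * R') / 3 * Ab
       + (r + 8 * R') / 9 * AR ->
  Q <= (8 * r + R') / 9 * Ar + (5 * r + 4 * R') / 3 * Aa
       + 2 / 9 * (2 * r + 7 * R') * AR ->
  3 * Ab <= Ar + 2 * AR ->
  Q <= R' * Ab + r * Aa
       + 2 / 3 * ((r + 2 * R') * AR + (2 * r + R') * Ar).
Proof.
move=> r0 rR; set Xb := (X in Q <= X -> _) => Qb.
set Xa := (X in Q <= X -> _) => Qa chord.
have R0 : 0 < R' by exact: lt_trans rR.
have p0 : 0 < 4 * r + 5 * R' by lra.
have q0 : 0 < 5 * r + 4 * R' by lra.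
(* [Xc] will contain neither [Ab] nor [Aa], so matching the coefficients [R'] of [Ab] and [r] of
   [Aa] in the target forces [u] and [v]. *)
pose u := 3 * R' / (4 * r + 5 * R'); pose v := 3 * r / (5 * r + 4 * R').
have u0 : 0 <= u by rewrite divr_ge0 ?ltW//; lra.
have v0 : 0 <= v by rewrite divr_ge0 ?ltW//; lra.
(* This bound and the next leave a nonnegative weight for [Xc]. *)
have u1 : u <= 2 / 3 by rewrite ler_pdivrMr//; lra.
have v1 : v <= 1 / 3 by rewrite ler_pdivrMr//; lra.
(* [Xb] with [Ab] replaced by its chord value: the bound from linear interpolation between [r] and
   [R']. *)
pose Xc := Xb + (4 * r + 5 * R') / 3 * ((Ar + 2 * AR) / 3 - Ab).
have Qc : Q <= Xc.
  apply: (le_trans Qb); rewrite lerDl mulr_ge0//; [|lra].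
  by rewrite divr_ge0// ltW.
have -> : R' * Ab + r * Aa + 2 / 3 * ((r + 2 * R') * AR + (2 * r + R') * Ar) =
    u * Xb + v * Xa + (1 - u - v) * Xc.
  by rewrite /Xc /Xb /Xa /u /v; field; rewrite !lt0r_neq0.
have w0 : 0 <= 1 - u - v by lra.
have -> : Q = u * Q + v * Q + (1 - u - v) * Q by ring.
by rewrite !lerD// ler_wpM2l.
Qed.

End convex_combination.

(** * Translation of the center to the origin and assembly of the bounds *)

Theorem theorem5p3 (R : realType) (U : set (R * R)) (O : R * R) (r R' : R)
  (f : R * R -> R) :
  convex_set U ->
  0 < r -> r < R' ->
  annulus O r R' `<=` U ->
  convex_function U f ->
  (@area_measure R).-integrable (annulus O r R') (EFin \o f) ->
  (forall s, s \in [:: R'; r; (r + 2 * R') / 3; (2 * r + R') / 3] ->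
     (@lebesgue_measure R).-integrable `[0, 2 * pi]%classic
        (fun t => (f (circ O s t) * s)%:E)) ->
  Avg_area f (annulus O r R') <=
    3^-1 * (R' / (r + R') * Avg_circle f O ((r + 2 * R') / 3)
            + r / (r + R') * Avg_circle f O ((2 * r + R') / 3))
  + 2 / 3 * ((r + 2 * R') / (3 * (r + R')) * Avg_circle f O R'
             + (2 * r + R') / (3 * (r + R')) * Avg_circle f O r).
Proof.
move=> _ r0 rR DU fU iD iC.
pose tr (p : R * R) := (p.1 + O.1, p.2 + O.2).
pose h (p : R * R) := f (tr p).
pose A s := Rintegral (@lebesgue_measure R) `[0, 2 * pi]%classic
  (fun t => h (circ (0, 0) s t)).
have R0 : 0 < R' by exact: lt_trans rR.
have trC s t : tr (circ (0, 0) s t) = circ O s t.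
  by rewrite /tr /circ/=; congr pair; ring.
have mtr := measurable_translation O.
have trD : tr @^-1` annulus O r R' = ring_set r R'.
  by apply/seteqP; split => p;
    rewrite /annulus /ring_set /Defs.edist /norm2 /tr/= !addrK.
have mann : measurable (annulus O r R' : set (measurableTypeR R * measurableTypeR R)).
  have -> : annulus O r R' = (fun p => (p.1 + - O.1, p.2 + - O.2)) @^-1` ring_set r R'.
    by [].
  have mtrN := measurable_translation (- O.1, - O.2).
  by have := measurable_preimage_preserved mtrN (measurable_ring_set r R').
have [c c0 ringE] := @area_ring_set R.
have mutr (X : set (measurableTypeR R * measurableTypeR R)) : measurable X ->
    area_measure (tr @^-1` X) = area_measure X by exact: area_translation.
have areaD : Area (annulus O r R') = c * (R' ^+ 2 - r ^+ 2).
  by rewrite /Area -(mutr _ mann) trD ringE// ltW.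
have ih : (@area_measure R).-integrable (ring_set r R') (EFin \o h).
  by rewrite -trD; exact: (integrable_preserved mtr mutr mann iD).
have intD : Rintegral (@area_measure R) (annulus O r R') f =
    Rintegral (@area_measure R) (ring_set r R') h.
  rewrite /Rintegral -(integral_preserved mtr mutr mann (measurable_int _ iD)).
  by rewrite -[X in _ = fine (integral _ X _)]trD.
have mI : measurable (`[0, 2 * pi]%classic : set (measurableTypeR R)).
  exact: measurable_itv.
(* The arc-length factor [s] is divided out, leaving integrals in the angle only. *)
have ic (s : R) : 0 < s -> s \in [:: R'; r; (r + 2 * R') / 3; (2 * r + R') / 3] ->
    (@lebesgue_measure R).-integrable `[0, 2 * pi]%classic
       (fun t => (h (circ (0, 0) s t))%:E).
  move=> s0 /iC i; have := integrableZl mI s^-1 i.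
  apply: eq_integrable => // t _ /=.
  by rewrite -EFinM /h trC mulrC mulfK// lt0r_neq0.
have avgC (s : R) : 0 < s -> s \in [:: R'; r; (r + 2 * R') / 3; (2 * r + R') / 3] ->
    Avg_circle f O s = (2 * pi)^-1 * A s.
  move=> s0 sin; rewrite /Avg_circle.
  have -> : (fun t => f (circ O s t) * s) = (fun t => h (circ (0, 0) s t) * s).
    by apply/funext => t; rewrite /h trC.
  rewrite RintegralZr//; last exact: ic.
  by rewrite -/(A s) invfM mulrACA mulVf ?mulr1// lt0r_neq0.
(* Convexity along the ray of angle [t], cleared of denominators so that [s1 = s3] is allowed. *)
have hconv (t s1 s2 s3 : R) : r <= s1 -> s1 <= s2 -> s2 <= s3 -> s3 <= R' ->
    (s3 - s1) * h (circ (0, 0) s2 t) <=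
    (s3 - s2) * h (circ (0, 0) s1 t) + (s2 - s1) * h (circ (0, 0) s3 t).
  move=> r1 s12 s23 s3R; have [s13|s13] := eqVneq s1 s3.
    have e : s2 = s1 by apply/eqP; rewrite eq_le s12 s13 s23.
    by rewrite e -s13 !subrr !mul0r addr0.
  have d0 : 0 < s3 - s1 by rewrite subr_gt0 lt_neqAle s13 (le_trans s12).
  have UC s : r <= s -> s <= R' -> U (circ O s t).
    move=> rs sR; apply: DU; rewrite -trC.
    have : ring_set r R' (circ (0, 0) s t).
      by rewrite /ring_set/= norm2_circ ?rs// (le_trans (ltW r0)).
    by rewrite -trD.
  have k01 : 0 <= (s3 - s2) / (s3 - s1) <= 1.
    by apply/andP; split; [apply: divr_ge0; lra|rewrite ler_pdivrMr//; lra].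
  have := convex_function_segment fU (UC s1 r1 (le_trans s12 (le_trans s23 s3R)))
    (UC s3 (le_trans r1 (le_trans s12 s23)) s3R) k01.
  rewrite -(ler_pM2l d0) /h !trC.
  set p := (X in f X); set q := circ O s2 t.
  have -> : p = q.
    by rewrite /p /q /circ/=; congr pair; field; exact: lt0r_neq0.
  by move=> /le_trans; apply; rewrite le_eqVlt; apply/orP; left; apply/eqP;
    field; exact: lt0r_neq0.
set a := (2 * r + R') / 3 in iC ic avgC *.
set b := (r + 2 * R') / 3 in iC ic avgC *.
have [ra ab bR] : [/\ r < a, a < b & b < R'] by rewrite /a /b; split; lra.
have a0 : 0 < a by exact: lt_trans ra.
have b0 : 0 < b by exact: lt_trans ab.
have bound x : r < x -> x < R' -> x \in [:: R'; r; b; a] ->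
    2 * pi * Rintegral (@area_measure R) (ring_set r R') h <=
    c / 3 * ((x - r) * (x + 2 * r) * A r + (R' - r) * (r + x + R') * A x
             + (R' - x) * (2 * R' + x) * A R').
  move=> rx xR xin; apply: three_radii_bound => // s.
  rewrite !inE => /or3P[] /eqP ->; apply: ic => //; rewrite ?inE ?eqxx ?orbT//.
  exact: lt_trans rx.
(* [b] lies two thirds of the way from [r] to [R']; convexity on each ray is integrated over the
   angle. *)
have chord : 3 * A b <= A r + 2 * A R'.
  have ib : (@lebesgue_measure R).-integrable `[0, 2 * pi]%classic
      (EFin \o (fun t => h (circ (0, 0) b t))).
    by apply: ic; rewrite ?inE ?eqxx ?orbT.
  have ir : (@lebesgue_measure R).-integrable `[0, 2 * pi]%classic
      (EFin \o (fun t => h (circ (0, 0) r t))).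
    by apply: ic; rewrite ?inE ?eqxx ?orbT.
  have iR : (@lebesgue_measure R).-integrable `[0, 2 * pi]%classic
      (EFin \o (fun t => h (circ (0, 0) R' t))).
    by apply: ic; rewrite ?inE ?eqxx ?orbT.
  have i3b := integrableZl mI 3 ib.
  have i2R := integrableZl mI 2 iR.
  rewrite /A -!RintegralZl// -RintegralD//.
  apply: le_Rintegral => //; first exact: integrableD ir i2R.
  move=> t _; have := hconv t r b R' (lexx _) (ltW (lt_trans ra ab)) (ltW bR) (lexx _).
  have -> : R' - b = (R' - r) / 3 by rewrite /b; field.
  have -> : b - r = 2 * (R' - r) / 3 by rewrite /b; field.
  have d0 : 0 < R' - r by rewrite subr_gt0.
  by move=> H; rewrite -(ler_pM2l d0); lra.
rewrite /Avg_area areaD intD !avgC ?inE ?eqxx ?orbT//.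
have Tb := bound b (lt_trans ra ab) bR; have Ta := bound a ra (lt_trans ab bR).
move: Tb Ta; rewrite !inE !eqxx !orbT => /(_ isT) Tb /(_ isT) Ta.
set I := Rintegral (@area_measure R) (ring_set r R') h in Ta Tb *.
have d0 : 0 < R' - r by rewrite subr_gt0.
have p0 := pi_gt0 R.
have s0 : 0 < r + R' by rewrite addr_gt0.
have k0 : 0 < c * (R' - r) / 3 by rewrite divr_gt0// mulr_gt0.
have Eb : c / 3 * ((b - r) * (b + 2 * r) * A r + (R' - r) * (r + b + R') * A b
    + (R' - b) * (2 * R' + b) * A R') =
    (2 / 9 * (7 * r + 2 * R') * A r + (4 * r + 5 * R') / 3 * A b
     + (r + 8 * R') / 9 * A R') * (c * (R' - r) / 3).
  (* Generalizing [A b] first lets [b] be unfolded in the coefficients only. *)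
  by move: (A b); rewrite /b => ?; field.
have Ea : c / 3 * ((a - r) * (a + 2 * r) * A r + (R' - r) * (r + a + R') * A a
    + (R' - a) * (2 * R' + a) * A R') =
    ((8 * r + R') / 9 * A r + (5 * r + 4 * R') / 3 * A a
     + 2 / 9 * (2 * r + 7 * R') * A R') * (c * (R' - r) / 3).
  by move: (A a); rewrite /a => ?; field.
(* [P] stands for [pi]. Both sides of the goal are brought over the denominator 6 P (r + R'); the
   numerators are those compared in [trisection_mixture]. *)
have lhsE (P y : R) : 0 < P -> (c * (R' ^+ 2 - r ^+ 2))^-1 * y =
    2 * P * y / (c * (R' - r) / 3) / (6 * P * (r + R')).
  move=> P0; have -> : R' ^+ 2 - r ^+ 2 = (R' - r) * (r + R') by ring.
  by field; rewrite !lt0r_neq0.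
have rhsE (P yr ya yb yR : R) : 0 < P ->
    3^-1 * (R' / (r + R') * ((2 * P)^-1 * yb) + r / (r + R') * ((2 * P)^-1 * ya))
    + 2 / 3 * ((r + 2 * R') / (3 * (r + R')) * ((2 * P)^-1 * yR)
               + (2 * r + R') / (3 * (r + R')) * ((2 * P)^-1 * yr)) =
    (R' * yb + r * ya + 2 / 3 * ((r + 2 * R') * yR + (2 * r + R') * yr))
    / (6 * P * (r + R')).
  by move=> P0; field; rewrite !lt0r_neq0.
rewrite (lhsE _ _ p0) (rhsE _ _ _ _ _ p0) ler_pM2r ?invr_gt0 ?mulr_gt0//.
apply: trisection_mixture => //.
  by rewrite ler_pdivrMr// -Eb.
by rewrite ler_pdivrMr// -Ea.
Qed.
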